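(* Let $\mathbb{V}$ and $\mathbb{W}$ be two finite-dimensional non-zero vector spaces over a field $\mathbb{F}$. Let $\{\alpha_1,\ldots,\alpha_n\}$ and $\{\beta_1,\ldots,\beta_k\}$ be any bases of $\mathbb{V}$ and $\mathbb{W}$ respectively. If the non-zero component graphs $\Gamma(\mathbb{V}_\alpha)$ and $\Gamma(\mathbb{W}_\beta)$ are isomorphic as graphs, then $\mathbb{V}$ and $\mathbb{W}$ are isomorphic as vector spaces over $\mathbb{F}$.
   Context: For a finite-dimensional vector space $\mathbb{V}$ over $\mathbb{F}$ with basis $\{\alpha_1,\ldots,\alpha_n\}$ and null vector $\theta$, every $\mathbf{a}\in\mathbb{V}$ is written uniquely as $\mathbf{a}=a_1\alpha_1+\cdots+a_n\alpha_n$ with $a_i\in\mathbb{F}$. The non-zero component graph $\Gamma(\mathbb{V}_\alpha)$ with respect to this basis is the simple graph with vertex set $\mathbb{V}\setminus\{\theta\}$ in which two distinct vertices $\mathbf{a},\mathbf{b}$ are adjacent if and only if there is an index $i$ with $a_i\neq 0$ and $b_i\neq 0$. The graph $\Gamma(\mathbb{W}_\beta)$ is defined in the same way from $\mathbb{W}$ and $\{\beta_1,\ldots,\beta_k\}$. The field may be finite or infinite. A graph isomorphism is a bijection of vertex sets that preserves both adjacency and non-adjacency. *)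

(* Defs.v *)
From mathcomp Require Import all_boot all_order all_algebra.

Set Implicit Arguments.
Unset Strict Implicit.
Unset Printing Implicit Defensive.

Import GRing.Theory.
Local Open Scope ring_scope.

Record sgraph := SGraph {
  vertex :> Type;
  adj : rel vertex;
  adj_sym : symmetric adj;
  adj_irrefl : irreflexive adj
}.

Definition graph_isomorphic (G H : sgraph) : Prop :=
  exists f : G -> H,
    bijective f /\ (forall x y : G, adj (f x) (f y) = adj x y).

Section NonZeroComponentGraph.

Variables (F : fieldType) (V : vectType F) (n : nat) (alpha : n.-tuple V).

Definition nonzero_vector := {a : V | a != 0}.

(* When [alpha] is a basis, [coord alpha i a] is the coefficient a_i in
   a = a_1 alpha_1 + ... + a_n alpha_n (see [coord_basis]); [coord] has junk
   values outside the span of [alpha], so [nzc_graph] is meant to be used under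
   [basis_of fullv alpha]. *)
Definition nzc_adj (a b : nonzero_vector) : bool :=
  (a != b) &&
  [exists i : 'I_n,
     (coord alpha i (val a) != 0) && (coord alpha i (val b) != 0)].

Lemma nzc_adj_sym : symmetric nzc_adj.
Proof.
move=> a b; rewrite /nzc_adj eq_sym; congr (_ && _).
by apply: eq_existsb => i; rewrite andbC.
Qed.

Lemma nzc_adj_irrefl : irreflexive nzc_adj.
Proof. by move=> a; rewrite /nzc_adj eqxx. Qed.

Definition nzc_graph : sgraph := SGraph nzc_adj_sym nzc_adj_irrefl.

End NonZeroComponentGraph.

Definition vspace_isomorphic (F : fieldType) (V W : vectType F) : Prop :=
  exists f : {linear V -> W}, bijective f.

(* Main.v *)
From HB Require Import structures.
Require Import Defs.
From mathcomp Require Import all_boot all_order all_algebra.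

Set Implicit Arguments.
Unset Strict Implicit.
Unset Printing Implicit Defensive.

Import GRing.Theory.
Local Open Scope ring_scope.

(** The independence number of the non-zero component graph is the dimension:
    two distinct vertices are non-adjacent iff their supports are disjoint, so
    the basis vectors are independent, and choosing an index in each support
    injects any independent set into the set of indices of the basis. Isomorphic
    graphs thus come from spaces of equal dimension. This works uniformly for
    finite and infinite fields. *)

Lemma graph_isomorphic_sym (G H : sgraph) :
  graph_isomorphic G H -> graph_isomorphic H G.
Proof.
case=> f [[g fK gK] fadj]; exists g; split; first by exists f.
by move=> x y; rewrite -fadj !gK.
Qed.

(** An independent set is encoded as an injective family over ['I_m], since the vertex type may be
    infinite. The case [i = j] of the last hypothesis is harmless because [adj] is irreflexive. *)
Lemma nzc_independent_leq (F : fieldType) (V : vectType F) (n m : nat)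
    (alpha : n.-tuple V) (u : 'I_m -> nzc_graph alpha) :
  basis_of {:V} alpha -> injective u ->
  (forall i j, ~~ adj (u i) (u j)) -> (m <= n)%N.
Proof.
move=> alpha_basis u_inj u_indep.
have supp i : exists j : 'I_n, coord alpha j (val (u i)) != 0.
  apply/existsP; apply: contraT; rewrite negb_exists => /forallP coord0.
  suff: val (u i) == 0 by rewrite (negPf (valP (u i))).
  rewrite (coord_basis alpha_basis (memvf (val (u i)))) big1 // => j _.
  by have /negPn/eqP-> := coord0 j; rewrite scale0r.
pose g i := xchoose (supp i).
have g_inj : injective g.
  (* Distinct vertices choosing the same index would both be non-zero there, hence adjacent. *)
  move=> i j eq_g; apply: u_inj; apply/eqP; apply: contraT => neq_u.
  have := u_indep i j; rewrite /= /nzc_adj neq_u /= => /existsP[].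
  by exists (g i); rewrite {2}eq_g !(xchooseP (supp _)).
by have := leq_card g g_inj; rewrite !card_ord.
Qed.

Lemma nzc_graph_isomorphic_leq (F : fieldType) (V W : vectType F) (n k : nat)
    (alpha : n.-tuple V) (beta : k.-tuple W) :
  basis_of {:V} alpha -> basis_of {:W} beta ->
  graph_isomorphic (nzc_graph alpha) (nzc_graph beta) -> (n <= k)%N.
Proof.
move=> alpha_basis beta_basis [f [/bij_inj f_inj fadj]].
have alpha_free := basis_free alpha_basis.
have alpha_neq0 (i : 'I_n) : alpha`_i != 0.
  apply/eqP => alpha_i0; have := coord_free i i alpha_free.
  by rewrite alpha_i0 linear0 eqxx => /eqP; rewrite eq_sym oner_eq0.
pose e (i : 'I_n) : nzc_graph alpha := exist _ alpha`_i (alpha_neq0 i).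
have e_inj : injective e.
  move=> i j /(congr1 val) /= eq_alpha; apply/eqP; apply: contraT => neq_ij.
  have := coord_free i i alpha_free; rewrite eq_alpha coord_free //.
  by rewrite eq_sym (negPf neq_ij) eqxx => /eqP; rewrite eq_sym oner_eq0.
apply: (nzc_independent_leq (u := f \o e)) beta_basis (inj_comp f_inj e_inj) _.
(* Adjacency pulls back along [f] to the vectors of [alpha], whose coordinates are Kronecker deltas:
   no index [l] equals both [i] and [j] when these differ. *)
move=> i j; rewrite [adj _ _]fadj /= /nzc_adj negb_and negbK.
case: eqVneq => //= neq_e; rewrite negb_exists; apply/forallP => l.
rewrite !coord_free // negb_and !negbK.
case: (eqVneq l i) => [->|_]; last by rewrite eqxx.
have neq_ji : j != i by apply: contraNneq neq_e => ->.
by rewrite (negPf neq_ji) eqxx orbT.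
Qed.

Lemma basis_vspace_isomorphic (F : fieldType) (V W : vectType F) (n : nat)
    (alpha : n.-tuple V) (beta : n.-tuple W) :
  basis_of {:V} alpha -> basis_of {:W} beta -> vspace_isomorphic V W.
Proof.
move=> alpha_basis beta_basis.
pose f v := \sum_(i < n) coord alpha i v *: beta`_i.
pose g w := \sum_(i < n) coord beta i w *: alpha`_i.
have f_linear : linear f.
  move=> a u v; rewrite /f scaler_sumr -big_split; apply: eq_bigr => i _ /=.
  by rewrite linearP scalerDl scalerA.
pose fL := GRing.isLinear.Build F V W *:%R f f_linear.
pose f' : {linear V -> W} := HB.pack f fL.
exists f'; exists g => [v | w] /=.
  (* Only the right-hand [v] is expanded; by freeness of [beta], the [i]-th coordinate of [f v] is
     that of [v]. *)
  rewrite {2}(coord_basis alpha_basis (memvf v)); apply: eq_bigr => i _.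
  by rewrite coord_sum_free // (basis_free beta_basis).
rewrite {2}(coord_basis beta_basis (memvf w)); apply: eq_bigr => i _.
by rewrite coord_sum_free // (basis_free alpha_basis).
Qed.

Theorem theorem5p2 (F : fieldType) (V W : vectType F) (n k : nat)
    (alpha : n.-tuple V) (beta : k.-tuple W)
    (V_neq0 : ({:V} != 0)%VS) (W_neq0 : ({:W} != 0)%VS)
    (alpha_basis : basis_of {:V} alpha) (beta_basis : basis_of {:W} beta) :
  graph_isomorphic (nzc_graph alpha) (nzc_graph beta) ->
  vspace_isomorphic V W.
Proof.
move=> iso_VW.
have eq_nk : n = k.
  apply/eqP; rewrite eqn_leq (nzc_graph_isomorphic_leq _ _ iso_VW) //=.
  exact: nzc_graph_isomorphic_leq (graph_isomorphic_sym iso_VW).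
(* Eliminating the equality turns [beta] into an [n]-tuple, so that both bases share one index
   type. *)
case: _ / eq_nk beta beta_basis {iso_VW} => beta.
exact: basis_vspace_isomorphic alpha_basis.
Qed.
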